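(* There exists a finite constructible graph for which no domination map is a homomorphism. That is, there is a finite constructible graph $G$ such that for every construction order of $G$ and every domination map $\delta$ for this order, there are two adjacent vertices $u,v$ (in the domain of $\delta$) such that $\delta(u)$ and $\delta(v)$ are neither adjacent nor equal.
   Context: Graphs are undirected, loopless and connected. A vertex $u$ dominates a vertex $v\neq u$ in a graph if the set consisting of $v$ and all neighbours of $v$ is contained in the set consisting of $u$ and all neighbours of $u$. A finite graph $G$ is constructible if there is an ordering $x_1,\ldots,x_n$ of its vertices (a construction order) such that for every $k>1$, in the induced graph $G[x_1,\ldots,x_k]$ the vertex $x_k$ is dominated by $x_i$ for some $i<k$. A domination map for this order is a map $\delta$ sending each $x_k$ with $k>1$ to a vertex $x_i$, $i<k$, that dominates $x_k$ in $G[x_1,\dots,x_k]$ (so $\delta$ is defined on all vertices except the first vertex $x_1$). The construction order, and the domination map for a given order, are in general not unique. A domination map is a homomorphism if whenever $u$ and $v$ are adjacent vertices in its domain, their images are adjacent or equal. *)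

(* Defs.v *)
From mathcomp Require Import all_boot.

Set Implicit Arguments.
Unset Strict Implicit.
Unset Printing Implicit Defensive.

Record graph := Graph {
  vertex :> finType;
  edge : rel vertex;
  edge_sym : symmetric edge;
  edge_irr : irreflexive edge;
  edge_conn : forall x y : vertex, connect edge x y
}.

Arguments edge {g}.

Section Constructible.

Variable G : graph.
Implicit Types (A : {set G}) (s : seq G) (u v x : G).

(* Closed neighbourhood of v in the induced graph G[A]. *)
Definition closed_nbhd A v : {set G} := [set w in A | (w == v) || edge v w].

(* u dominates v in the induced graph G[A]. *)
Definition dominates A u v : bool :=
  [&& u \in A, v \in A, u != v & closed_nbhd A v \subset closed_nbhd A u].

Definition vertex_ordering s : Prop := uniq s /\ forall x, x \in s.

(* An ordering x_1, ..., x_n is a sequence s, with x_k at index k - 1;        *)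
(* [initial s x_k] is {x_1, ..., x_k}, and x_k is in the domain of the        *)
(* domination maps, i.e. k > 1, when [0 < index x_k s].                       *)
Definition initial s x : {set G} := [set y in take (index x s).+1 s].

Definition dom_domain s x : bool := 0 < index x s.

Definition construction_order s : Prop :=
  vertex_ordering s /\
  forall x, dom_domain s x ->
    exists2 u, index u s < index x s & dominates (initial s x) u x.

Definition constructible : Prop := exists s, construction_order s.

(* The value of d at the first vertex of s is irrelevant. *)
Definition domination_map s (d : G -> G) : Prop :=
  forall x, dom_domain s x ->
    index (d x) s < index x s /\ dominates (initial s x) (d x) x.

End Constructible.

(* Main.v *)
Require Import Defs.
From mathcomp Require Import all_boot.

Set Implicit Arguments.
Unset Strict Implicit.
Unset Printing Implicit Defensive.

(** The example triangulates a disc with boundary 0-2-5-3 and interior vertices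
    1, 4, 6, 7.  It has a single dominated vertex, 0, dominated only by 1; once
    0 is removed, 1 is the only dominated vertex, dominated only by 4; once 1 is
    removed as well, the dominated vertices are 2 (only by 6) and 3 (only by 7).
    So d 0 = 1, and the vertex preceding 0 and 1 in the order is a neighbour x
    of 0 for which d x is not adjacent to 1. *)

(** Reduces a check over ['I_n] to a boolean on naturals, which conversion evaluates. *)
Lemma all_iota_ord n (P : pred nat) :
  all P (iota 0 n) -> forall i : 'I_n, P i.
Proof. by move=> /allP Pn i; apply: Pn; rewrite mem_iota ltn_ord. Qed.

Lemma all2_iota_ord n (P : rel nat) :
  all (fun i => all (P i) (iota 0 n)) (iota 0 n) -> forall i j : 'I_n, P i j.
Proof.
move=> Pn i j; apply: (all_iota_ord (P := P i)).
exact: (all_iota_ord (P := fun k => all (P k) (iota 0 n))).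
Qed.

Definition disc_edges : seq (nat * nat) :=
  [:: (0, 1); (0, 2); (0, 3); (1, 2); (1, 3); (1, 4); (2, 4); (2, 5); (2, 6);
      (3, 4); (3, 5); (3, 7); (4, 6); (4, 7); (5, 6); (5, 7); (6, 7)].

Definition disc_adj : rel nat :=
  fun i j => ((i, j) \in disc_edges) || ((j, i) \in disc_edges).

Definition disc_rel : rel 'I_8 := fun x y => disc_adj x y.

Lemma disc_sym : symmetric disc_rel.
Proof. by move=> x y; apply: orbC. Qed.

Lemma disc_irr : irreflexive disc_rel.
Proof.
by move=> x; apply/negbTE; apply: (all_iota_ord (P := fun i => ~~ disc_adj i i)).
Qed.

Lemma disc_conn (x y : 'I_8) : connect disc_rel x y.
Proof.
(* Any two vertices, equal or not, have a common neighbour, so a walk of length two joins them. *)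
have /hasP[z] : has (fun z => disc_adj x z && disc_adj z y) (iota 0 8).
  exact: (all2_iota_ord
    (P := fun i j => has (fun k => disc_adj i k && disc_adj k j) (iota 0 8))).
rewrite mem_iota => z_lt8 /andP[xz zy].
by apply: (@connect_trans _ _ (Ordinal z_lt8)); apply: connect1.
Qed.

Definition disc : graph := Graph disc_sym disc_irr disc_conn.

(** Computable form of domination in [disc], with the vertex set given as a predicate on the labels
    0 to 7. *)
Definition nat_dominates (A : pred nat) (i j : nat) : bool :=
  [&& A i, A j, i != j &
    all (fun k => A k && ((k == j) || disc_adj j k) ==> (k == i) || disc_adj i k)
      (iota 0 8)].

Lemma dominates_discE (A : {set disc}) (P : pred nat) (x y : disc) :
  (forall z : 'I_8, (z \in A) = P z) ->
  dominates A x y = nat_dominates P x y.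
Proof.
move=> AP; rewrite /dominates /nat_dominates !AP; do 3!congr (_ && _).
apply/subsetP/allP => [sub k|sub z].
  rewrite mem_iota => k_lt8; apply/implyP => /andP[Pk jk].
  have := sub (Ordinal k_lt8); rewrite !inE AP /= Pk -!val_eqE /= => /(_ jk).
  by [].
rewrite !inE AP -!val_eqE => /andP[Pz zy].
by have := sub z; rewrite mem_iota ltn_ord Pz => /(_ isT)/implyP/(_ zy).
Qed.

Lemma disc_constructible : constructible disc.
Proof.
(* The order is 7, 6, ..., 0: the initial segment ending at [x] is the set of labels at least [x],
   and each [x < 7] has a dominating vertex of larger label there. *)
pose s : seq disc := rev (enum 'I_8).
have size_s : size s = 8 by rewrite size_rev size_enum_ord.
have uniq_s : uniq s by rewrite rev_uniq enum_uniq.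
have mem_s x : x \in s by rewrite mem_rev mem_enum.
have index_s (x : 'I_8) : index x s = 7 - x.
  have x_le7 : x <= 7 by rewrite -ltnS.
  have nth_s : nth x s (7 - x) = x.
    by rewrite nth_rev size_enum_ord ?ltnS ?leq_subr // subSS subKn ?nth_ord_enum.
  by rewrite -{1}nth_s index_uniq // size_s ltnS leq_subr.
exists s; split=> // x; rewrite /dom_domain index_s subn_gt0 => x_lt7.
have initial_s (z : 'I_8) : (z \in initial s x) = (x <= z).
  rewrite inE in_take // !index_s ltnS.
  by rewrite leq_sub2lE // -ltnS.
have : has (fun j => (x < j) && nat_dominates (leq x) j x) (iota 0 8).
  have := all_iota_ord (n := 8) (P := fun i => (i < 7) ==>
    has (fun j => (i < j) && nat_dominates (leq i) j i) (iota 0 8)) isT x.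
  by rewrite x_lt7.
case/hasP=> j; rewrite mem_iota => j_lt8 /andP[x_lt_j dom_jx].
exists (Ordinal j_lt8); last by rewrite (dominates_discE _ _ initial_s).
by rewrite !index_s /= ltn_sub2l.
Qed.

(** As the ordering is duplicate-free and exhaustive, the initial segment ending at [x] is the
    complement of [t]. An order can thus be analysed from its end, without knowing how it starts. *)
Lemma dominates_suffix (G : graph) (s t : seq G) (x : G) (d : G -> G) :
    vertex_ordering (rcons s x ++ t) -> s != [::] ->
    domination_map (rcons s x ++ t) d ->
  dom_domain (rcons s x ++ t) x /\ dominates [set v | v \notin t] (d x) x.
Proof.
move=> [uniq_st mem_st] s_neq0 dom_d.
have index_x : index x (rcons s x ++ t) = size s.
  move: uniq_st; rewrite cat_rcons cat_uniq /= => /and3P[_ /norP[xs _] _].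
  by rewrite index_cat (negbTE xs) /= eqxx addn0.
have dom_x : dom_domain (rcons s x ++ t) x by rewrite /dom_domain index_x lt0n size_eq0.
split=> //; have [_] := dom_d x dom_x; congr dominates.
apply/setP=> v; rewrite !inE index_x -(size_rcons s x) take_size_cat //.
have := mem_st v; move: uniq_st; rewrite mem_cat cat_uniq => /and3P[_ disj _].
case: (boolP (v \in t)) => [vt _|_]; last by rewrite orbF.
by apply/negbTE/negP => vs; case/hasP: disj; exists v.
Qed.

(** The tail enters through its labels [t], so that once these are known domination can be
    evaluated. *)
Lemma disc_suffix (s : seq disc) (t : seq nat) (x : disc) (u : seq disc) d :
    map val u = t ->
    vertex_ordering (rcons s x ++ u) -> s != [::] ->
    domination_map (rcons s x ++ u) d ->
  dom_domain (rcons s x ++ u) x /\ nat_dominates [pred k | k \notin t] (d x) x.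
Proof.
move=> <- ord_su s_neq0 dom_d.
have [dom_x dx] := dominates_suffix ord_su s_neq0 dom_d; split=> //.
rewrite -(dominates_discE (A := [set v | v \notin u])) // => z.
by rewrite !inE (mem_map val_inj).
Qed.

Theorem theorem2 :
  exists G : graph,
    constructible G /\
    forall (s : seq G) (d : G -> G),
      construction_order s -> domination_map s d ->
      exists u v : G,
        [/\ dom_domain s u, dom_domain s v, edge u v,
            ~~ edge (d u) (d v) & d u != d v].
Proof.
exists disc; split=> [|s d [ord_s _] dom_d]; first exact: disc_constructible.
have size_s : size s = 8.
  have [uniq_s mem_s] := ord_s; rewrite -(card_ord 8) -(card_uniqP uniq_s).
  by apply: eq_card.
(* Peel off the last three vertices [z], [y], [x]. With eight vertices the rest is nonempty, so all
   three lie in the domain of [d]. *)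
case/lastP: s => // s x in ord_s dom_d size_s *.
case/lastP: s => // s y in ord_s dom_d size_s *.
case/lastP: s => // s z in ord_s dom_d size_s *.
have s_neq0 : s != [::] by case: s size_s {ord_s dom_d}.
set r := rcons _ x in ord_s dom_d size_s *.
have def_rx : r = rcons (rcons (rcons s z) y) x ++ [::] by rewrite cats0.
have def_ry : r = rcons (rcons s z) y ++ [:: x] by rewrite cats1.
have def_rz : r = rcons s z ++ [:: y; x] by rewrite -cat_rcons cats1.
have [dom_x] : dom_domain r x /\ nat_dominates [pred k | k \notin [::]] (d x) x.
  rewrite def_rx in ord_s dom_d *; apply: (disc_suffix (u := [::])) => //.
  by rewrite -size_eq0 !size_rcons.
have /implyP/[apply] := all2_iota_ord (n := 8)
  (P := fun i j => nat_dominates [pred k | k \notin [::]] i j ==>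
    (j == 0) && (i == 1)) isT (d x) x.
case/andP=> /eqP x0 /eqP dx1.
have [_] : dom_domain r y /\ nat_dominates [pred k | k \notin [:: 0]] (d y) y.
  rewrite def_ry in ord_s dom_d *; apply: disc_suffix => //; first by rewrite /= x0.
  by rewrite -size_eq0 size_rcons.
(* Evaluation over all pairs without vertex 0 forces [y] to be 1, which determines the vertices
   remaining at [z]. *)
have /implyP/[apply] := all2_iota_ord (n := 8)
  (P := fun i j => nat_dominates [pred k | k \notin [:: 0]] i j ==> (j == 1))
  isT (d y) y.
move/eqP=> y1.
have [dom_z] : dom_domain r z /\ nat_dominates [pred k | k \notin [:: 1; 0]] (d z) z.
  rewrite def_rz in ord_s dom_d *; apply: disc_suffix => //.
  by rewrite /= x0 y1.
(* The surviving pairs ([d z], [z]) are (6, 2) and (7, 3). Both have [z] adjacent to 0, which is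
   [x], and [d z] neither adjacent nor equal to 1, which is [d x]. *)
have /implyP/[apply] := all2_iota_ord (n := 8)
  (P := fun i j => nat_dominates [pred k | k \notin [:: 1; 0]] i j ==>
    [&& disc_adj j 0, ~~ disc_adj i 1 & i != 1]) isT (d z) z.
case/and3P=> zx ndzx dzx; exists z, x; split=> //.
- by rewrite /= /disc_rel x0.
- by rewrite /= /disc_rel dx1.
by apply: contraNneq dzx => ->; rewrite dx1.
Qed.
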